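(* Let $n\ge 2$, let $\Bbbk$ be a field containing a primitive $n$-th root of unity $\omega$, and let $H_{n^2}$ be the Taft Hopf algebra. The orbits of right group-like projections of $H_{n^2}$ under the automorphism group of the Hopf algebra $H_{n^2}$ are the singletons $$\left\{\frac{d}{n}\sum_{i=0}^{\frac nd-1}g^{di}\right\}\quad\text{for } d\mid n,$$ and the set $\{P_\beta : \beta\in\Bbbk^\times\}$, where $P_\beta=\frac1n\sum_{i=0}^{n-1}(g+\beta x)^i$.
   Context: The Taft Hopf algebra $H_{n^2}$ is the algebra $\Bbbk[x]/(x^n)\rtimes\Bbbk[G]$, where $G=\mathbb{Z}/n\mathbb{Z}$ is generated by $g$ (so $g^n=1$, $x^n=0$) and $gxg^{-1}=\omega x$; its coalgebra structure is $\Delta(g)=g\otimes g$, $\Delta(x)=x\otimes 1+g\otimes x$. A right group-like projection in a Hopf algebra is a non-zero idempotent $P$ with $\Delta(P)(1\otimes P)=P\otimes P=(1\otimes P)\Delta(P)$. Since $\Bbbk$ contains a primitive $n$-th root of unity, $n$ is invertible in $\Bbbk$. $\Bbbk^\times=\Bbbk\setminus\{0\}$. *)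

(* Defs.v *)
From HB Require Import structures.
From mathcomp Require Import all_boot all_order all_algebra.
From mathcomp Require Import classical_sets.

Set Implicit Arguments.
Unset Strict Implicit.
Unset Printing Implicit Defensive.

Import GRing.Theory.
Local Open Scope ring_scope.

(* A finite-dimensional unital algebra with a chosen basis (e_a), given by its
   structure constants: 1 = \sum_a ba_one a e_a and
   e_a e_b = \sum_c ba_mul a b c e_c.  Keeping the basis explicit makes the
   tensor product of two such algebras again one, on the product of the
   indexing types. *)
Record basedAlg (k : fieldType) := BasedAlg {
  ba_idx : finType;
  ba_one : ba_idx -> k;
  ba_mul : ba_idx -> ba_idx -> ba_idx -> k;
  ba_mulA : forall a b c d,
    \sum_p ba_mul b c p * ba_mul a p d = \sum_p ba_mul a b p * ba_mul p c d;
  ba_mul1l : forall b c, \sum_a ba_one a * ba_mul a b c = (b == c)%:R;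
  ba_mul1r : forall a c, \sum_b ba_one b * ba_mul a b c = (a == c)%:R;
  ba_one_neq0 : exists a, ba_one a != 0
}.

Definition ba_sort (k : fieldType) (A : basedAlg k) : Type :=
  {ffun ba_idx A -> k^o}.
Coercion ba_sort : basedAlg >-> Sortclass.

Section BasedAlgTheory.
Variables (k : fieldType) (A : basedAlg k).

HB.instance Definition _ := GRing.Lmodule.copy (ba_sort A)
  {ffun ba_idx A -> k^o}.

Definition ba_coord (u : A) (a : ba_idx A) : k :=
  (u : {ffun ba_idx A -> k^o}) a.

Definition ba_vec (f : ba_idx A -> k) : A := [ffun a => f a : k^o].

Definition ba_basis (a : ba_idx A) : A := ba_vec (fun b => (b == a)%:R).

Definition ba_times (u v : A) : A := ba_vec (fun c =>
  \sum_a \sum_b ba_coord u a * ba_coord v b * ba_mul a b c).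

Lemma ba_coordE f a : ba_coord (ba_vec f) a = f a.
Proof. by rewrite /ba_coord ffunE. Qed.

Lemma ba_eqP (u v : A) : ba_coord u =1 ba_coord v -> u = v.
Proof. by move=> uv; apply/ffunP=> a; apply: uv. Qed.

Lemma ba_coordD (u v : A) a :
  ba_coord (u + v) a = ba_coord u a + ba_coord v a.
Proof. by rewrite /ba_coord ffunE. Qed.

Lemma ba_coord0 a : ba_coord 0 a = 0.
Proof. by rewrite /ba_coord ffunE. Qed.

Lemma ba_coordZ c (u : A) a : ba_coord (c *: u) a = c * ba_coord u a.
Proof. by rewrite /ba_coord ffunE. Qed.

Fact ba_timesA : associative ba_times.
Proof.
move=> u v w; apply: ba_eqP => d; rewrite !ba_coordE.
transitivity (\sum_a \sum_b \sum_c ba_coord u a * ba_coord v b * ba_coord w c *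
    \sum_p ba_mul b c p * ba_mul a p d).
  apply: eq_bigr => a _.
  under eq_bigr => p _ do rewrite ba_coordE mulr_sumr mulr_suml.
  rewrite exchange_big; apply: eq_bigr => b _ /=.
  under eq_bigr => p _ do rewrite mulr_sumr mulr_suml.
  rewrite exchange_big; apply: eq_bigr => c _ /=.
  by rewrite mulr_sumr; apply: eq_bigr => p _; rewrite !mulrA.
under [RHS]eq_bigr => p _.
  under eq_bigr => c _ do rewrite ba_coordE !mulr_suml.
  over.
rewrite /=; under [RHS]eq_bigr => p _ do rewrite exchange_big /=.
rewrite [RHS]exchange_big; apply: eq_bigr => a _ /=.
under [RHS]eq_bigr => p _.
  under eq_bigr => c _ do rewrite !mulr_suml.
  rewrite exchange_big /=; over.
rewrite /= [RHS]exchange_big; apply: eq_bigr => b _ /=.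
rewrite [RHS]exchange_big; apply: eq_bigr => c _ /=.
rewrite ba_mulA mulr_sumr; apply: eq_bigr => p _.
by rewrite !mulrA; congr (_ * _); rewrite -!mulrA; congr (_ * (_ * _)); rewrite mulrC.
Qed.

Let one : A := ba_vec (@ba_one k A).

Fact ba_times1l : left_id one ba_times.
Proof.
move=> u; apply: ba_eqP => c; rewrite ba_coordE exchange_big /=.
rewrite (bigD1 c) //= [X in _ + X]big1 ?addr0 => [|b bc].
  under eq_bigr => a _ do rewrite ba_coordE mulrAC mulrC.
  by rewrite -mulr_sumr ba_mul1l eqxx mulr1.
under eq_bigr => a _ do rewrite ba_coordE mulrAC mulrC.
by rewrite -mulr_sumr ba_mul1l (negPf bc) mulr0.
Qed.

Fact ba_times1r : right_id one ba_times.
Proof.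
move=> u; apply: ba_eqP => c; rewrite ba_coordE.
rewrite (bigD1 c) //= [X in _ + X]big1 ?addr0 => [|b bc].
  under eq_bigr => a _ do rewrite ba_coordE -mulrA.
  by rewrite -mulr_sumr ba_mul1r eqxx mulr1.
under eq_bigr => a _ do rewrite ba_coordE -mulrA.
by rewrite -mulr_sumr ba_mul1r (negPf bc) mulr0.
Qed.

Fact ba_timesDl : left_distributive ba_times +%R.
Proof.
move=> u v w; apply: ba_eqP => c; rewrite ba_coordD !ba_coordE -big_split.
apply: eq_bigr => a _; rewrite -big_split; apply: eq_bigr => b _ /=.
by rewrite ba_coordD !mulrDl.
Qed.

Fact ba_timesDr : right_distributive ba_times +%R.
Proof.
move=> u v w; apply: ba_eqP => c; rewrite ba_coordD !ba_coordE -big_split.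
apply: eq_bigr => a _; rewrite -big_split; apply: eq_bigr => b _ /=.
by rewrite ba_coordD mulrDr !mulrDl.
Qed.

Fact ba_oner_neq0 : one != 0.
Proof.
have [a a0] := ba_one_neq0 A; apply: contra_neq a0 => /(congr1 (ba_coord^~ a)).
by rewrite ba_coordE ba_coord0.
Qed.

HB.instance Definition _ := GRing.Zmodule_isNzRing.Build (ba_sort A)
  ba_timesA ba_times1l ba_times1r ba_timesDl ba_timesDr ba_oner_neq0.

Fact ba_scalerAl (c : k) (u v : A) : c *: (u * v) = (c *: u) * v.
Proof.
apply: ba_eqP => d; rewrite ba_coordZ !ba_coordE mulr_sumr.
apply: eq_bigr => a _; rewrite mulr_sumr; apply: eq_bigr => b _.
by rewrite ba_coordZ !mulrA.
Qed.

HB.instance Definition _ := GRing.Lmodule_isLalgebra.Build k (ba_sort A)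
  ba_scalerAl.

Fact ba_scalerAr (c : k) (u v : A) : c *: (u * v) = u * (c *: v).
Proof.
apply: ba_eqP => d; rewrite ba_coordZ !ba_coordE mulr_sumr.
apply: eq_bigr => a _; rewrite mulr_sumr; apply: eq_bigr => b _.
by rewrite ba_coordZ !mulrA [c * _]mulrC.
Qed.

HB.instance Definition _ := GRing.Lalgebra_isAlgebra.Build k (ba_sort A)
  ba_scalerAr.

Definition ba_lin (V : lmodType k) (F : ba_idx A -> V) (u : A) : V :=
  \sum_a ba_coord u a *: F a.

End BasedAlgTheory.

Section Tensor.
Variable k : fieldType.

Section TensorAlg.
Variables A B : basedAlg k.
Local Notation I := (ba_idx A * ba_idx B)%type.

Definition tens_one (p : I) : k := ba_one p.1 * ba_one p.2.
Definition tens_mul (p q r : I) : k := ba_mul p.1 q.1 r.1 * ba_mul p.2 q.2 r.2.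

Fact tens_mulA p q r s :
  \sum_t tens_mul q r t * tens_mul p t s = \sum_t tens_mul p q t * tens_mul t r s.
Proof.
transitivity ((\sum_t ba_mul q.1 r.1 t * ba_mul p.1 t s.1) *
              (\sum_t ba_mul q.2 r.2 t * ba_mul p.2 t s.2)).
  rewrite mulr_suml [LHS](eq_bigr (fun t => ba_mul q.1 r.1 t.1 *
    ba_mul p.1 t.1 s.1 * (ba_mul q.2 r.2 t.2 * ba_mul p.2 t.2 s.2))).
    rewrite -(pair_bigA _ (fun i j => ba_mul q.1 r.1 i * ba_mul p.1 i s.1 *
      (ba_mul q.2 r.2 j * ba_mul p.2 j s.2))) /=.
    by apply: eq_bigr => i _; rewrite mulr_sumr.
  by move=> t _; rewrite mulrACA.
rewrite !ba_mulA mulr_suml [RHS](eq_bigr (fun t => ba_mul p.1 q.1 t.1 *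
  ba_mul t.1 r.1 s.1 * (ba_mul p.2 q.2 t.2 * ba_mul t.2 r.2 s.2))).
  rewrite -(pair_bigA _ (fun i j => ba_mul p.1 q.1 i * ba_mul i r.1 s.1 *
    (ba_mul p.2 q.2 j * ba_mul j r.2 s.2))) /=.
  by apply: eq_bigr => i _; rewrite mulr_sumr.
by move=> t _; rewrite mulrACA.
Qed.

Fact tens_mul1l q r : \sum_p tens_one p * tens_mul p q r = (q == r)%:R.
Proof.
transitivity ((\sum_p ba_one p * ba_mul p q.1 r.1) *
              (\sum_p ba_one p * ba_mul p q.2 r.2)).
  rewrite mulr_suml [LHS](eq_bigr (fun t => ba_one t.1 * ba_mul t.1 q.1 r.1 *
    (ba_one t.2 * ba_mul t.2 q.2 r.2))) => [|t _]; last by rewrite mulrACA.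
  rewrite -(pair_bigA _ (fun i j => ba_one i * ba_mul i q.1 r.1 *
    (ba_one j * ba_mul j q.2 r.2))) /=.
  by apply: eq_bigr => i _; rewrite mulr_sumr.
by rewrite !ba_mul1l -natrM mulnb.
Qed.

Fact tens_mul1r p r : \sum_q tens_one q * tens_mul p q r = (p == r)%:R.
Proof.
transitivity ((\sum_q ba_one q * ba_mul p.1 q r.1) *
              (\sum_q ba_one q * ba_mul p.2 q r.2)).
  rewrite mulr_suml [LHS](eq_bigr (fun t => ba_one t.1 * ba_mul p.1 t.1 r.1 *
    (ba_one t.2 * ba_mul p.2 t.2 r.2))) => [|t _]; last by rewrite mulrACA.
  rewrite -(pair_bigA _ (fun i j => ba_one i * ba_mul p.1 i r.1 *
    (ba_one j * ba_mul p.2 j r.2))) /=.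
  by apply: eq_bigr => i _; rewrite mulr_sumr.
by rewrite !ba_mul1r -natrM mulnb.
Qed.

Fact tens_one_neq0 : exists p, tens_one p != 0.
Proof.
have [[a a0] [b b0]] := (ba_one_neq0 A, ba_one_neq0 B).
by exists (a, b); rewrite mulf_neq0.
Qed.

Definition tensAlg : basedAlg k :=
  BasedAlg tens_mulA tens_mul1l tens_mul1r tens_one_neq0.

Definition tens (u : A) (v : B) : tensAlg :=
  @ba_vec k tensAlg (fun p => ba_coord u p.1 * ba_coord v p.2).

End TensorAlg.

Definition tens_map (A B A' B' : basedAlg k) (f : A -> A') (g : B -> B') :
    tensAlg A B -> tensAlg A' B' :=
  @ba_lin k (tensAlg A B) (tensAlg A' B')
    (fun p => tens (f (ba_basis p.1)) (g (ba_basis p.2))).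

End Tensor.

Notation "u '⊗' v" := (tens u v) (at level 40, left associativity) : ring_scope.

Section HopfNotions.
Variables (k : fieldType) (A : basedAlg k).
Variables (Delta : A -> tensAlg A A) (eps : A -> k) (S : A -> A).

Definition right_grouplike_projection (P : A) : Prop :=
  [/\ P != 0, P * P = P,
      Delta P * (1 ⊗ P) = P ⊗ P & (1 ⊗ P) * Delta P = P ⊗ P].

Definition hopf_automorphism (f : {lrmorphism A -> A}) : Prop :=
  [/\ bijective f,
      forall u, Delta (f u) = tens_map f f (Delta u),
      forall u, eps (f u) = eps u &
      forall u, S (f u) = f (S u)].

Definition hopf_orbit (P : A) : set A :=
  [set Q | exists f : {lrmorphism A -> A}, hopf_automorphism f /\ Q = f P]%classic.

End HopfNotions.

Section TaftStructure.
Variables (k : fieldType) (n : nat) (w : k) (wP : n.-primitive_root w).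

(* The index (a, b) stands for the monomial x^a g^b of k[x]/(x^n) # k[Z/n];
   since g x g^-1 = w x, one has
   (x^a g^b) (x^c g^d) = w^(b c) x^(a+c) g^(b+d), with x^(a+c) = 0 as soon as
   a + c >= n and g^(b+d) depending only on b + d mod n. *)
Local Notation I := ('I_n * 'I_n)%type.

Definition taft_struct_one (p : I) : k := ((p.1 == 0 :> nat)%N && (p.2 == 0 :> nat)%N)%:R.

Definition taft_struct_mul (p q r : I) : k :=
  if (r.1 == p.1 + q.1 :> nat)%N && (r.2 == (p.2 + q.2) %% n :> nat)%N
  then w ^+ (p.2 * q.1) else 0.

Let n_gt0 : (0 < n)%N := prim_order_gt0 wP.
Let o0 : 'I_n := Ordinal n_gt0.

Fact taft_mul1l q r : \sum_p taft_struct_one p * taft_struct_mul p q r = (q == r)%:R.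
Proof.
rewrite (bigD1 (o0, o0)) //= big1 => [|[a b]].
  rewrite addr0 /taft_struct_one /taft_struct_mul /= mul1r !add0n mul0n modn_small //.
  case: q r => [a b] [c d] /=; rewrite xpair_eqE -!val_eqE /=.
  by rewrite [a == c :> nat]eq_sym [b == d :> nat]eq_sym; case: ifP.
rewrite /taft_struct_one /= xpair_eqE -!val_eqE /= => /negPf->.
by rewrite mul0r.
Qed.

Fact taft_mul1r p r : \sum_q taft_struct_one q * taft_struct_mul p q r = (p == r)%:R.
Proof.
rewrite (bigD1 (o0, o0)) //= big1 => [|[a b]].
  rewrite addr0 /taft_struct_one /taft_struct_mul /= mul1r !addn0 muln0 modn_small //.
  case: p r => [a b] [c d] /=; rewrite xpair_eqE -!val_eqE /=.
  by rewrite [a == c :> nat]eq_sym [b == d :> nat]eq_sym; case: ifP.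
rewrite /taft_struct_one /= xpair_eqE -!val_eqE /= => /negPf->.
by rewrite mul0r.
Qed.

Fact taft_one_neq0 : exists p, taft_struct_one p != 0.
Proof. by exists (o0, o0); rewrite /taft_struct_one /= oner_eq0. Qed.

Let omod (m : nat) : 'I_n := Ordinal (ltn_pmod m n_gt0).

Local Fact taft_struct_sum (m l : nat) (F : I -> k) :
  (\sum_(t : I) (if (t.1 == m :> nat) && (t.2 == l %% n :> nat)%N then F t else 0)
   = if insub m is Some i then F (i, omod l) else 0).
Proof.
case: insubP => [i mn im|]; last first.
  move=> nm; apply: big1 => [[a b] _] /=; case: eqP => //= am.
  by rewrite -am ltn_ord in nm.
rewrite (bigD1 (i, omod l)) //= im !eqxx big1 ?addr0 // => [[a b]] /=.
by rewrite xpair_eqE -!val_eqE /= im => /negPf->.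
Qed.

Fact taft_mulA p q r s :
  \sum_t taft_struct_mul q r t * taft_struct_mul p t s = \sum_t taft_struct_mul p q t * taft_struct_mul t r s.
Proof.
transitivity (if (s.1 == p.1 + q.1 + r.1 :> nat)%N &&
                 (s.2 == (p.2 + q.2 + r.2) %% n :> nat)%N
              then w ^+ (p.2 * q.1 + p.2 * r.1 + q.2 * r.1) else 0).
  under eq_bigr => t _ do rewrite {1}/taft_struct_mul (fun_if ( *%R^~ _)) mul0r.
  rewrite taft_struct_sum; case: insubP => [i _ ie|].
    rewrite /taft_struct_mul /= ie modnDmr !addnA; case: ifP => _; last by rewrite mulr0.
    by rewrite -exprD mulnDr addnC.
  rewrite -leqNgt => big; case: eqP => //= se.
  by have := ltn_ord s.1; rewrite se -addnA ltnNge (leq_trans big (leq_addl _ _)).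
under [RHS]eq_bigr => t _ do rewrite {1}/taft_struct_mul (fun_if ( *%R^~ _)) mul0r.
rewrite taft_struct_sum; case: insubP => [i _ ie|].
  rewrite /taft_struct_mul /= ie modnDml; case: ifP => _; last by rewrite mulr0.
  rewrite -addnA -mulnDl exprD; congr (_ * _).
  by rewrite [RHS]exprM (prim_expr_mod wP) -exprM.
rewrite -leqNgt => big; case: eqP => //= se.
by have := ltn_ord s.1; rewrite se ltnNge (leq_trans big (leq_addr _ _)).
Qed.

End TaftStructure.

Section Taft.
Variables (k : fieldType) (n : nat) (w : k) (wP : n.-primitive_root w).

Definition taft : basedAlg k :=
  BasedAlg (taft_mulA wP) (taft_mul1l wP) (taft_mul1r wP) (taft_one_neq0 wP).

(* For n = 1 this x is 0. *)
Definition taft_g : taft := @ba_vec k taft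
  (fun p => ((p.1 == 0 :> nat)%N && (p.2 == 1 %% n :> nat)%N)%:R).
Definition taft_x : taft := @ba_vec k taft
  (fun p => ((p.1 == 1 :> nat)%N && (p.2 == 0 :> nat)%N)%:R).

Let mon (a b : nat) : taft := @ba_vec k taft
  (fun p => ((p.1 == a :> nat)%N && (p.2 == b %% n :> nat)%N)%:R).

Local Fact monM a b c d :
  mon a b * mon c d = w ^+ (b * c) *: mon (a + c) (b + d).
Proof.
have n_gt0 := prim_order_gt0 wP.
apply: ba_eqP => r; rewrite ba_coordZ !ba_coordE.
have [an|na] := ltnP a n; last first.
  have big e (i : 'I_n) : (i == a + e :> nat)%N = false.
    by apply/eqP => ie; have := ltn_ord i; rewrite ie ltnNge (leq_trans na (leq_addr _ _)).
  rewrite big /= mulr0 big1 // => [[i j] _]; rewrite big1 // => q _.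
  by rewrite ba_coordE /= -[a]addn0 big !mul0r.
have [cn|nc] := ltnP c n; last first.
  have big e (i : 'I_n) : (i == e + c :> nat)%N = false.
    by apply/eqP => ie; have := ltn_ord i; rewrite ie ltnNge (leq_trans nc (leq_addl _ _)).
  rewrite big /= mulr0 big1 // => p _; rewrite big1 // => [[i j] _].
  by rewrite !ba_coordE /= -[c]add0n big mulr0 mul0r.
pose om m : 'I_n := Ordinal (ltn_pmod m n_gt0).
rewrite (bigD1 (Ordinal an, om b)) //= [X in _ + X]big1 ?addr0; last first.
  move=> [i j]; rewrite xpair_eqE -!val_eqE /= => ne; rewrite big1 // => q _.
  by rewrite ba_coordE /= (negPf ne) !mul0r.
rewrite (bigD1 (Ordinal cn, om d)) //= [X in _ + X]big1 ?addr0; last first.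
  move=> [i j]; rewrite xpair_eqE -!val_eqE /= => ne.
  by rewrite !ba_coordE /= (negPf ne) mulr0 mul0r.
rewrite !ba_coordE /= !eqxx !mul1r /taft_struct_mul /= modnDm.
case: ifP => _; last by rewrite mulr0.
by rewrite mulr1 !exprM (prim_expr_mod wP).
Qed.

Local Fact mon_x : taft_x = mon 1 0.
Proof. by apply: ba_eqP => p; rewrite !ba_coordE mod0n. Qed.

Local Fact mon_1 : 1 = mon 0 0.
Proof. by apply: ba_eqP => p; rewrite !ba_coordE mod0n. Qed.

Local Fact mon_xX a : taft_x ^+ a = mon a 0.
Proof.
elim: a => [|a IH]; first by rewrite expr0 mon_1.
by rewrite exprS IH mon_x monM mul0n expr0 scale1r.
Qed.

Local Fact mon_gX b : taft_g ^+ b = mon 0 b.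
Proof.
elim: b => [|b IH]; first by rewrite expr0 mon_1.
by rewrite exprS IH [taft_g]/(mon 0 1) monM muln0 expr0 scale1r.
Qed.

Lemma taft_basisE a b : ba_basis ((a, b) : ba_idx taft) = taft_x ^+ a * taft_g ^+ b.
Proof.
rewrite mon_xX mon_gX monM mul0n expr0 scale1r addn0 add0n.
by apply: ba_eqP => -[c d]; rewrite !ba_coordE /= modn_small.
Qed.

Lemma taft_g_order : taft_g ^+ n = 1.
Proof. by rewrite mon_gX mon_1; apply: ba_eqP => p; rewrite !ba_coordE modnn mod0n. Qed.

Lemma taft_x_nilp : taft_x ^+ n = 0.
Proof.
rewrite mon_xX; apply: ba_eqP => p.
by rewrite ba_coordE ba_coord0 (ltn_eqF (ltn_ord p.1)).
Qed.

Lemma taft_gx : taft_g * taft_x = w *: (taft_x * taft_g).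
Proof.
by rewrite mon_x [taft_g]/(mon 0 1) !monM mul0n muln1 expr0 expr1 scale1r add0n addn0.
Qed.

(* The multiplicative extension of Delta g = g ⊗ g and
   Delta x = x ⊗ 1 + g ⊗ x, written on the basis x^a g^b. *)
Definition taft_Delta : taft -> tensAlg taft taft :=
  @ba_lin k taft (tensAlg taft taft) (fun p =>
    (taft_x ⊗ 1 + taft_g ⊗ taft_x) ^+ p.1 * (taft_g ⊗ taft_g) ^+ p.2).

(* eps x = 0 and eps g = 1 *)
Definition taft_eps : taft -> k := @ba_lin k taft k^o (fun p => ((p.1 == 0 :> nat)%N)%:R).

(* The antimultiplicative extension of S g = g^-1 = g^(n-1) and
   S x = - g^-1 x. *)
Definition taft_S : taft -> taft := @ba_lin k taft taft (fun p =>
  (taft_g ^+ n.-1) ^+ p.2 * (- (taft_g ^+ n.-1 * taft_x)) ^+ p.1).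

Definition taft_orbits : set (set taft) :=
  [set hopf_orbit taft_Delta taft_eps taft_S P |
     P in right_grouplike_projection taft_Delta]%classic.

Definition taft_group_proj (d : nat) : taft :=
  (d%:R / n%:R) *: \sum_(0 <= i < n %/ d) taft_g ^+ (d * i).

Definition taft_P (beta : k) : taft :=
  n%:R^-1 *: \sum_(0 <= i < n) (taft_g + beta *: taft_x) ^+ i.

End Taft.

Arguments taft_g {k n w} wP.
Arguments taft_x {k n w} wP.
Arguments taft_Delta {k n w} wP _.
Arguments taft_eps {k n w} wP _.
Arguments taft_S {k n w} wP _.
Arguments taft_orbits {k n w} wP _.
Arguments taft_group_proj {k n w} wP d.
Arguments taft_P {k n w} wP beta.

(* Main.v *)
Require Import Defs.
From HB Require Import structures.
From mathcomp Require Import all_boot all_order all_algebra.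
From mathcomp Require Import classical_sets.
From mathcomp Require Import ring.

Set Implicit Arguments.
Unset Strict Implicit.
Unset Printing Implicit Defensive.

Import GRing.Theory.
Local Open Scope ring_scope.
Local Open Scope classical_set_scope.

(** The key object attached to an element P is the set L of all u such that
    Delta(u) (1 ⊗ P) = u ⊗ P. Since Delta is multiplicative, L is a subalgebra,
    and P belongs to L when P is a right group-like projection. Reading the
    identity through the coordinate forms of the first tensor factor (lemma
    [absorbed_slice]) gives, for u in L and each monomial x^i g^m, an equation
    v P = u_(i,m) P, where v is the part of Delta(u) lying over x^i g^m.
    If x^a g^b is a monomial of highest x-degree in u, its equation reads
    g^b P = P, because nothing of higher x-degree can contribute
    ([slice_Delta_top], [absorbed_top]).

    Let P be a right group-like projection. If P has x-degree 0, then every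
    monomial g^b of P satisfies g^b P = P, so P lies in the span of the powers
    of some g^d fixing P, d | n, and must be the average of these powers
    ([idem_span_pow]). If P has x-degree a > 0 at x^a g^b, the equation over
    x^(a-1) g^(b+1) involves only two monomials ([slice_Delta_subtop]) and says
    that c g P + s x P = c P with s <> 0. As x P <> 0 for a nonzero idempotent,
    c <> 0, and P is fixed by y = g + beta x with beta = s / c <> 0. Then y is
    in L, and g^b P = P forces b = 0 mod n. Subtracting from P a combination of
    the powers of y (where x^m occurs only in y^m) yields an element of L
    without any monomial x^m g^0; its monomials of highest x-degree would have
    to be of that form, so it vanishes. Hence P lies in the span of the powers
    of y, and is their average P_beta ([rgp_cases]).

    Conversely the average E of the powers of z = g^d or z = g + beta x is
    fixed by z on both sides, which gives the projection identities for z, then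
    for its powers, then for E ([rgp_avg_pow]); that (g + beta x)^n = 1 is the
    vanishing of the Gaussian binomial coefficients at w.

    Finally, the Hopf automorphisms are exactly g |-> g, x |-> lam x with
    lam <> 0. They exist by the universal property of the algebra
    ([taft_scale_hopf]); the converse ([hopf_automorphismP]) applies the same
    reading of top coordinates to the coproducts of the images of g and x. They
    fix the projections of the group algebra and carry P_beta to
    P_(beta lam). *)

(** * Averages of the powers of a root of unity *)

Section Average.
Variables (k : fieldType) (A : algType k).
Implicit Types (y P : A) (N : nat).

Definition avg_pow y N : A := N%:R^-1 *: \sum_(0 <= i < N) y ^+ i.

Lemma expr_fixl y P i : y * P = P -> y ^+ i * P = P.
Proof. by move=> yP; elim: i => [|i IH]; rewrite ?mul1r // exprS -mulrA IH. Qed.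

Lemma expr_fixr y P i : P * y = P -> P * y ^+ i = P.
Proof. by move=> Py; elim: i => [|i IH]; rewrite ?mulr1 // exprSr mulrA IH. Qed.

Lemma sum_pow_shift y N : y ^+ N = 1 ->
  \sum_(0 <= i < N) y ^+ i.+1 = \sum_(0 <= i < N) y ^+ i.
Proof.
case: N => [|N] yN; first by rewrite !big_geq.
by rewrite big_nat_recr // [RHS]big_nat_recl //= yN expr0 addrC.
Qed.

Lemma avg_pow_fixl y N : y ^+ N = 1 -> y * avg_pow y N = avg_pow y N.
Proof.
move=> yN; rewrite /avg_pow -scalerAr mulr_sumr -[in RHS](sum_pow_shift yN).
by under eq_bigr => i _ do rewrite -exprS.
Qed.

Lemma avg_pow_fixr y N : y ^+ N = 1 -> avg_pow y N * y = avg_pow y N.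
Proof.
move=> yN; rewrite /avg_pow -scalerAl mulr_suml -[in RHS](sum_pow_shift yN).
by under eq_bigr => i _ do rewrite -exprSr.
Qed.

Lemma avg_pow_absorb y N P : N%:R != 0 :> k -> y * P = P -> avg_pow y N * P = P.
Proof.
move=> N0 yP; rewrite -scalerAl mulr_suml.
under eq_bigr => i _ do rewrite expr_fixl //.
by rewrite sumr_const_nat subn0 -scaler_nat scalerA mulVf // scale1r.
Qed.

Lemma avg_pow_idem y N : N%:R != 0 :> k -> y ^+ N = 1 ->
  avg_pow y N * avg_pow y N = avg_pow y N.
Proof. by move=> N0 yN; rewrite avg_pow_absorb // avg_pow_fixl. Qed.

(** Multiplying a polynomial in y by the average E of the powers of y gives a
    multiple of E; a nonzero idempotent multiple of E is E itself. *)
Lemma idem_span_pow y N P (I : finType) (c : I -> k) (r : I -> nat) :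
    N%:R != 0 :> k -> y ^+ N = 1 -> P != 0 -> P * P = P -> y * P = P ->
    P = \sum_i c i *: y ^+ r i -> P = avg_pow y N.
Proof.
move=> N0 yN P0 PP yP Pspan; set E := avg_pow y N.
have EE : E * E = E by apply: avg_pow_idem.
have PE : P = (\sum_i c i) *: E.
  rewrite -[LHS](avg_pow_absorb N0 yP) {1}Pspan mulr_sumr scaler_suml.
  by apply: eq_bigr => i _; rewrite -scalerAr expr_fixr // avg_pow_fixr.
move: PP P0; rewrite PE; set s := \sum_i c i.
rewrite -scalerAl -scalerAr scalerA EE => /eqP.
rewrite -subr_eq0 -scalerBl scaler_eq0 -[X in _ * _ - X]mulr1 -mulrBr mulf_eq0 subr_eq0.
case/orP => [/orP[] /eqP->|/eqP->]; by rewrite ?scale0r ?scaler0 ?eqxx ?scale1r.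
Qed.

End Average.

(** * Tensor products of algebras given by structure constants *)

Section BasedAlgebras.
Variable k : fieldType.

Lemma ba_coord_sum (A : basedAlg k) (I : finType) (F : I -> A) a :
  ba_coord (\sum_i F i) a = \sum_i ba_coord (F i) a.
Proof.
by apply: (big_morph (fun u => ba_coord u a)) => [u v|];
  rewrite ?ba_coordD ?ba_coord0.
Qed.

Lemma ba_decomp (A : basedAlg k) (u : A) : u = \sum_a ba_coord u a *: ba_basis a.
Proof.
apply: ba_eqP => a; rewrite ba_coord_sum (bigD1 a) //= big1 ?addr0 => [|b ba].
  by rewrite ba_coordZ ba_coordE eqxx mulr1.
by rewrite ba_coordZ ba_coordE eq_sym (negPf ba) mulr0.
Qed.

Lemma ba_lin_basis (A : basedAlg k) (V : lmodType k) (F : ba_idx A -> V) a :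
  ba_lin F (ba_basis a) = F a.
Proof.
rewrite /ba_lin (bigD1 a) //= big1 ?addr0 => [|b ba].
  by rewrite ba_coordE eqxx scale1r.
by rewrite ba_coordE (negPf ba) scale0r.
Qed.

Lemma ba_lin_is_linear (A : basedAlg k) (V : lmodType k) (F : ba_idx A -> V) :
  linear (@ba_lin k A V F).
Proof.
move=> c u v; rewrite /ba_lin scaler_sumr -big_split; apply: eq_bigr => a _ /=.
by rewrite ba_coordD ba_coordZ scalerDl scalerA.
Qed.

HB.instance Definition _ (A : basedAlg k) (V : lmodType k) (F : ba_idx A -> V) :=
  GRing.isLinear.Build k A V _ (@ba_lin k A V F) (ba_lin_is_linear F).

Lemma eq_on_basis (A : basedAlg k) (V : lmodType k) (f g : {linear A -> V}) :
  (forall a, f (ba_basis a) = g (ba_basis a)) -> f =1 g.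
Proof.
move=> fg u; rewrite [u]ba_decomp !linear_sum; apply: eq_bigr => a _.
by rewrite !linearZ fg.
Qed.

Variables A B : basedAlg k.

Lemma tens_coord (u : A) (v : B) p :
  @ba_coord k (tensAlg A B) (u ⊗ v) p = ba_coord u p.1 * ba_coord v p.2.
Proof. by rewrite ba_coordE. Qed.

Lemma tens_is_linear (u : A) : linear (@tens k A B u).
Proof.
move=> c v v'; apply: ba_eqP => p; rewrite ba_coordD ba_coordZ !tens_coord.
by rewrite ba_coordD ba_coordZ mulrDr mulrCA.
Qed.

HB.instance Definition _ (u : A) :=
  GRing.isLinear.Build k B (tensAlg A B) _ (@tens k A B u) (tens_is_linear u).

Definition tensr (v : B) (u : A) : tensAlg A B := u ⊗ v.

Lemma tensr_is_linear (v : B) : linear (tensr v).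
Proof.
move=> c u u'; apply: ba_eqP => p; rewrite ba_coordD ba_coordZ !tens_coord.
by rewrite ba_coordD ba_coordZ mulrDl mulrA.
Qed.

HB.instance Definition _ (v : B) :=
  GRing.isLinear.Build k A (tensAlg A B) _ (tensr v) (tensr_is_linear v).

Lemma tensZl c (u : A) (v : B) : (c *: u) ⊗ v = c *: (u ⊗ v).
Proof. exact: (linearZ_LR (tensr v)). Qed.

Lemma tensDl (u u' : A) (v : B) : (u + u') ⊗ v = u ⊗ v + u' ⊗ v.
Proof. exact: (linearD (tensr v)). Qed.

Lemma tens_suml (I : finType) (F : I -> A) (v : B) :
  (\sum_i F i) ⊗ v = \sum_i F i ⊗ v.
Proof. exact: (linear_sum (tensr v)). Qed.

Lemma tensM (u u' : A) (v v' : B) : (u ⊗ v) * (u' ⊗ v') = (u * u') ⊗ (v * v').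
Proof.
apply: ba_eqP => r; rewrite tens_coord !ba_coordE.
transitivity (\sum_a \sum_b \sum_a' \sum_b'
    ba_coord u a * ba_coord v b * (ba_coord u' a' * ba_coord v' b') *
    (ba_mul a a' r.1 * ba_mul b b' r.2)).
  rewrite [RHS]pair_bigA; apply: eq_bigr => p _; rewrite [RHS]pair_bigA /=.
  by apply: eq_bigr => q _; rewrite !tens_coord.
rewrite mulr_suml; apply: eq_bigr => a _; rewrite mulr_suml exchange_big.
apply: eq_bigr => a' _ /=; rewrite mulr_sumr; apply: eq_bigr => b _.
rewrite mulr_sumr; apply: eq_bigr => b' _.
by rewrite [RHS]mulrACA [X in _ = X * _]mulrACA.
Qed.

Lemma tens11 : (1 : A) ⊗ (1 : B) = 1.
Proof. by apply: ba_eqP => p; rewrite !ba_coordE. Qed.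

Lemma tensX (u : A) (v : B) i : (u ⊗ v) ^+ i = (u ^+ i) ⊗ (v ^+ i).
Proof. by elim: i => [|i IH]; rewrite ?tens11 // !exprS IH tensM. Qed.

Lemma tens_basis (p : ba_idx A * ba_idx B) :
  ba_basis p.1 ⊗ ba_basis p.2 = ba_basis (p : ba_idx (tensAlg A B)).
Proof.
apply: ba_eqP => -[a b]; case: p => a' b'.
by rewrite !ba_coordE /= -natrM mulnb xpair_eqE.
Qed.

(** Pairing the first tensor factor with a coordinate form. *)
Definition slice (a : ba_idx A) (t : tensAlg A B) : B :=
  @ba_vec k B (fun b => @ba_coord k (tensAlg A B) t (a, b)).

Lemma slice_coord a t b :
  ba_coord (slice a t) b = @ba_coord k (tensAlg A B) t (a, b).
Proof. by rewrite ba_coordE. Qed.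

Lemma slice_is_linear a : linear (slice a).
Proof.
move=> c t t'; apply: ba_eqP => b.
by rewrite ba_coordD ba_coordZ !slice_coord ba_coordD ba_coordZ.
Qed.

HB.instance Definition _ a :=
  GRing.isLinear.Build k (tensAlg A B) B _ (slice a) (slice_is_linear a).

Lemma slice_tens a (u : A) (v : B) : slice a (u ⊗ v) = ba_coord u a *: v.
Proof. by apply: ba_eqP => b; rewrite ba_coordZ slice_coord tens_coord. Qed.

Lemma slice_mulr a (t : tensAlg A B) (v : B) :
  slice a (t * (1 ⊗ v)) = slice a t * v.
Proof.
rewrite [t]ba_decomp mulr_suml !linear_sum mulr_suml; apply: eq_bigr => p _ /=.
rewrite -scalerAl !linearZ -tens_basis tensM mulr1 /=.
by rewrite !slice_tens !scalerAl.
Qed.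

End BasedAlgebras.

HB.instance Definition _ (k : fieldType) (A B A' B' : basedAlg k)
    (f : A -> A') (g : B -> B') :=
  GRing.Linear.copy (tens_map f g)
    (ba_lin (fun p : ba_idx (tensAlg A B) =>
       f (ba_basis p.1) ⊗ g (ba_basis p.2))).

Lemma tens_map_tens (k : fieldType) (A B A' B' : basedAlg k)
    (f : {linear A -> A'}) (g : {linear B -> B'}) (u : A) (v : B) :
  tens_map f g (u ⊗ v) = f u ⊗ g v.
Proof.
rewrite [v]ba_decomp !linear_sum; apply: eq_bigr => b _; rewrite !linearZ /=.
congr (_ *: _); rewrite [u]ba_decomp linear_sum !tens_suml linear_sum.
apply: eq_bigr => a _; rewrite linearZ !tensZl linearZ /=.
by rewrite (tens_basis (a, b)) /tens_map ba_lin_basis.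
Qed.

(** * Gaussian binomial coefficients at a root of unity *)

Section GaussianBinomials.
Variables (k : fieldType) (w : k).

Definition qint m : k := \sum_(i < m) w ^+ i.

Definition qfact m : k := \prod_(i < m) qint i.+1.

(** The Gaussian binomial coefficients, through the Pascal rule matching
    right multiplication by X + Y when Y X = w X Y. *)
Fixpoint qbin (m j : nat) : k :=
  match m, j with
  | _, 0 => 1
  | 0, _.+1 => 0
  | m'.+1, j'.+1 => w ^+ j * qbin m' j + qbin m' j'
  end.

Lemma qbin0 m : qbin m 0 = 1. Proof. by case: m. Qed.

Lemma qbin_small m j : (m < j)%N -> qbin m j = 0.
Proof.
elim: m j => [|m IH] [|j] //= mj.
by rewrite !IH ?mulr0 ?addr0 // ltnW.
Qed.

Lemma qbinn m : qbin m m = 1.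
Proof. by elim: m => //= m IH; rewrite qbin_small // mulr0 add0r. Qed.

Lemma qintS m : qint m.+1 = w * qint m + 1.
Proof.
rewrite /qint big_ord_recl expr0 addrC mulr_sumr; congr (_ + _).
by apply: eq_bigr => i _; rewrite -exprS.
Qed.

Lemma qintD i j : qint (i + j) = w ^+ j * qint i + qint j.
Proof.
elim: j => [|j IH]; first by rewrite addn0 /qint big_ord0 expr0 mul1r addr0.
by rewrite addnS !qintS IH mulrDr mulrA -exprS addrA.
Qed.

Lemma qbin1 m : qbin m 1 = qint m.
Proof.
elim: m => [|m IH]; first by rewrite /qint big_ord0.
by rewrite qintS -IH /= qbin0 expr1.
Qed.

Lemma qfactS m : qfact m.+1 = qfact m * qint m.+1.
Proof. by rewrite /qfact big_ord_recr. Qed.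

(** The quotient formula for Gaussian binomials, free of divisions since the
    q-factorials may vanish. *)
Lemma qbin_fact i j : qbin (i + j) j * (qfact i * qfact j) = qfact (i + j).
Proof.
have fact0 : qfact 0 = 1 by rewrite /qfact big_ord0.
elim: j i => [|j IHj] i; first by rewrite addn0 qbin0 fact0 mulr1 mul1r.
elim: i => [|i IHi]; first by rewrite qbinn fact0 !mul1r.
have := IHj i.+1; rewrite -addSnnS in IHi *.
have -> : qfact (i.+1 + j.+1) =
    qfact (i.+1 + j) * (w ^+ j.+1 * qint i.+1 + qint j.+1).
  by rewrite -qintD !addnS qfactS.
have -> : qbin (i.+1 + j.+1) j.+1 =
    w ^+ j.+1 * qbin (i.+1 + j) j.+1 + qbin (i.+1 + j) j.
  by rewrite addnS.
move=> IHj'; rewrite -IHj' !qfactS in IHi *; ring: IHi.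
Qed.

Hypothesis (n : nat) (wP : n.-primitive_root w).

Lemma qint_neq0 m : (0 < m < n)%N -> qint m != 0.
Proof.
case/andP=> m0 mn; apply/eqP => q0; have := subrX1 w m.
rewrite -/(qint m) q0 mulr0 => /eqP; rewrite subr_eq0 -(prim_order_dvd wP).
by move/(dvdn_leq m0); rewrite leqNgt mn.
Qed.

Lemma qfact_neq0 m : (m < n)%N -> qfact m != 0.
Proof.
move=> mn; apply/prodf_neq0 => i _; apply: qint_neq0.
exact: leq_ltn_trans mn.
Qed.

(** In [qbin_fact] the q-factorial of n vanishes, because w^n = 1 and w <> 1,
    while those of j and n - j do not. *)
Lemma qbin_prim0 j : (0 < j < n)%N -> qbin n j = 0.
Proof.
case/andP=> j0 jn; have n0 := prim_order_gt0 wP.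
have qn : qfact n = 0.
  case: n wP j0 jn {n0} => // m mP j0 jm; rewrite qfactS.
  have w1 : w - 1 != 0.
    rewrite subr_eq0 -[w]expr1 -(prim_order_dvd mP) dvdn1.
    by apply: contraTneq jm => -[->]; case: j j0.
  have : (w - 1) * qint m.+1 = 0 by rewrite -subrX1 (prim_expr_order mP) subrr.
  by move/eqP; rewrite mulf_eq0 (negPf w1) /= => /eqP->; rewrite mulr0.
have /eqP := qbin_fact (n - j) j; rewrite subnK 1?ltnW // qn mulf_eq0.
by rewrite mulf_eq0 !(negPf (qfact_neq0 _)) ?ltn_subrL ?j0 ?orbF // => /eqP.
Qed.

Variables (A : algType k) (X Y : A).
Hypothesis YX : Y * X = w *: (X * Y).

Lemma qcommX i j : Y ^+ j * X ^+ i = w ^+ (j * i) *: (X ^+ i * Y ^+ j).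
Proof.
have YXi : Y * X ^+ i = w ^+ i *: (X ^+ i * Y).
  elim: i => [|i IH]; first by rewrite mulr1 mul1r scale1r.
  rewrite exprSr mulrA IH -scalerAl -!mulrA YX -scalerAr scalerA.
  by rewrite -exprSr.
elim: j => [|j IH]; first by rewrite mulr1 mul1r scale1r.
rewrite exprS -mulrA IH -scalerAr. rewrite (mulrA Y) YXi -scalerAl scalerA.
by rewrite -mulrA -exprD mulSn addnC.
Qed.

Lemma qbinomial m :
  (X + Y) ^+ m = \sum_(j < m.+1) qbin m j *: (X ^+ (m - j) * Y ^+ j).
Proof.
elim: m => [|m IH]; first by rewrite big_ord_recl big_ord0 addr0 scale1r mulr1.
rewrite exprSr IH mulrDr !mulr_suml [RHS]big_ord_recl /= expr0 scale1r mulr1.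
under [X in _ = _ + X]eq_bigr => j _ do rewrite subSS scalerDl.
rewrite big_split addrA /=; congr (_ + _); last first.
  by apply: eq_bigr => j _; rewrite -scalerAl -mulrA -exprSr.
rewrite big_ord_recl big_ord_recr /= expr0 subn0 qbin0 scale1r mulr1 -exprSr.
rewrite qbin_small // mulr0 scale0r addr0; congr (_ + _).
apply: eq_bigr => j _; rewrite -scalerAl -mulrA.
have -> : Y ^+ j.+1 * X = w ^+ j.+1 *: (X * Y ^+ j.+1).
  by have := qcommX 1 j.+1; rewrite muln1.
rewrite -scalerAr scalerA [_ * w ^+ _]mulrC mulrA -exprSr.
by rewrite /bump leq0n add1n subnSK.
Qed.

(** All the mixed terms vanish by [qbin_prim0]. This is what makes the relations
    x^n = 0 and g^n = 1 pass to the coproduct and to g + beta x. *)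
Lemma qfreshman : (X + Y) ^+ n = X ^+ n + Y ^+ n.
Proof.
have := prim_order_gt0 wP; rewrite qbinomial; move: qbin_prim0.
case: n => // m bin0 _; rewrite big_ord_recr big_ord_recl.
rewrite big1 => [|j _]; last by rewrite bin0 ?scale0r //= ltnS ltn_ord.
by rewrite Monoid.mulm1 qbin0 qbinn !scale1r subnn mulr1 mul1r.
Qed.

End GaussianBinomials.

(** * Monomials, homomorphisms and the coproduct of the Taft algebra *)

Section TaftLift.
Variables (k : fieldType) (n : nat) (w : k) (wP : n.-primitive_root w).
Local Notation H := (taft wP).
Local Notation x := (taft_x wP).
Local Notation g := (taft_g wP).

Definition omod (m : nat) : 'I_n := Ordinal (ltn_pmod m (prim_order_gt0 wP)).

Lemma taft_g_mod b : g ^+ b = g ^+ (b %% n)%N.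
Proof. by rewrite -(expr_mod _ (taft_g_order wP)). Qed.

Lemma taft_x_big a : (n <= a)%N -> x ^+ a = 0.
Proof. by move=> na; rewrite -(subnK na) exprD taft_x_nilp mulr0. Qed.

Lemma taft_mon_basis a b (an : (a < n)%N) :
  x ^+ a * g ^+ b = ba_basis ((Ordinal an, omod b) : ba_idx H).
Proof. by rewrite taft_basisE /= -taft_g_mod. Qed.

Lemma taft_basis_mon (p : ba_idx H) : ba_basis p = x ^+ p.1 * g ^+ p.2.
Proof. by case: p => a b; rewrite taft_basisE. Qed.

Lemma taft_coord_mon a b (p : ba_idx H) :
  ba_coord (x ^+ a * g ^+ b) p = ((p.1 == a :> nat) && (p.2 == b %% n :> nat)%N)%:R.
Proof.
have [an|na] := ltnP a n; first by rewrite (taft_mon_basis b an) ba_coordE; case: p.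
by rewrite taft_x_big // mul0r ba_coord0 ltn_eqF // (leq_trans _ na).
Qed.

Lemma taft_coord_gX b (p : ba_idx H) :
  ba_coord (g ^+ b) p = ((p.1 == 0 :> nat)%N && (p.2 == b %% n :> nat)%N)%:R.
Proof. by rewrite -[g ^+ b]mul1r (taft_coord_mon 0). Qed.

Lemma taft_decomp (u : H) : u = \sum_p ba_coord u p *: (x ^+ p.1 * g ^+ p.2).
Proof.
by rewrite [LHS]ba_decomp; apply: eq_bigr => p _; rewrite taft_basis_mon.
Qed.

Section Lift.
Variables (B : algType k) (X G : B).

(** The universal property of the Taft algebra: a pair (X, G) satisfying its
    defining relations extends to a unique algebra homomorphism. The proofs of
    the relations are arguments so that the homomorphism structure can be
    inferred from the term. *)
Definition taft_lift of G ^+ n = 1 & X ^+ n = 0 & G * X = w *: (X * G) : H -> B :=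
  ba_lin (fun p : ba_idx H => X ^+ p.1 * G ^+ p.2).

Hypotheses (Gn : G ^+ n = 1) (Xn : X ^+ n = 0) (GX : G * X = w *: (X * G)).

Lemma taft_lift_mon a b : taft_lift Gn Xn GX (x ^+ a * g ^+ b) = X ^+ a * G ^+ b.
Proof.
have [an|na] := ltnP a n; last first.
  by rewrite taft_x_big // -(subnK na) exprD Xn mulr0 !mul0r /taft_lift linear0.
by rewrite taft_mon_basis /taft_lift ba_lin_basis /= expr_mod.
Qed.

Lemma taft_lift_g : taft_lift Gn Xn GX g = G.
Proof. by rewrite -[g]mul1r (taft_lift_mon 0 1) mul1r. Qed.

Lemma taft_lift_x : taft_lift Gn Xn GX x = X.
Proof. by rewrite -[x]mulr1 (taft_lift_mon 1 0) mulr1. Qed.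

HB.instance Definition _ := GRing.Linear.copy (taft_lift Gn Xn GX)
  (ba_lin (fun p : ba_idx H => X ^+ p.1 * G ^+ p.2)).

Lemma taft_lift_monoid : monoid_morphism (taft_lift Gn Xn GX).
Proof.
split=> [|u v]; first by rewrite -[1 in LHS]mulr1 (taft_lift_mon 0 0) mulr1.
rewrite [u]taft_decomp mulr_suml !linear_sum mulr_suml; apply: eq_bigr => p _.
rewrite -scalerAl !linearZ -scalerAl; congr (_ *: _) => /=.
rewrite [v]taft_decomp mulr_sumr !linear_sum mulr_sumr; apply: eq_bigr => q _.
rewrite -scalerAr !linearZ -scalerAr; congr (_ *: _) => /=.
have mon (C : algType k) (Z K : C) : K * Z = w *: (Z * K) ->
    Z ^+ p.1 * K ^+ p.2 * (Z ^+ q.1 * K ^+ q.2) =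
    w ^+ (p.2 * q.1) *: (Z ^+ (p.1 + q.1) * K ^+ (p.2 + q.2)).
  move=> KZ; rewrite -mulrA (mulrA (K ^+ _)) (qcommX KZ) -scalerAl -scalerAr.
  by rewrite !exprD !mulrA.
by rewrite (mon _ _ _ (taft_gx wP)) linearZ /= !taft_lift_mon (mon _ _ _ GX).
Qed.

HB.instance Definition _ :=
  GRing.isMonoidMorphism.Build H B (taft_lift Gn Xn GX) taft_lift_monoid.

End Lift.

Local Notation Dx := (x ⊗ 1 + g ⊗ x).
Local Notation Dg := (g ⊗ g).

Lemma Delta_gx_comm : (g ⊗ x) * (x ⊗ 1) = w *: ((x ⊗ 1) * (g ⊗ x)).
Proof. by rewrite !tensM mulr1 mul1r taft_gx tensZl. Qed.

Fact Delta_rel_g : Dg ^+ n = 1.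
Proof. by rewrite tensX taft_g_order tens11. Qed.

Fact Delta_rel_x : Dx ^+ n = 0.
Proof.
rewrite (qfreshman wP Delta_gx_comm) !tensX taft_x_nilp.
by rewrite linear0 addr0 -[0]/(0 : H) -(scale0r 1) tensZl scale0r.
Qed.

Fact Delta_rel_gx : Dg * Dx = w *: (Dx * Dg).
Proof.
by rewrite mulrDr mulrDl !tensM mulr1 mul1r taft_gx tensZl linearZ scalerDr.
Qed.

(* The coproduct is the instance of the universal property at
   (x ⊗ 1 + g ⊗ x, g ⊗ g), hence multiplicative. *)
HB.instance Definition _ := GRing.LRMorphism.copy (taft_Delta wP)
  (taft_lift Delta_rel_g Delta_rel_x Delta_rel_gx).

Lemma Delta_g : taft_Delta wP g = g ⊗ g.
Proof. exact: (taft_lift_g Delta_rel_g Delta_rel_x Delta_rel_gx). Qed.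

Lemma Delta_x : taft_Delta wP x = x ⊗ 1 + g ⊗ x.
Proof. exact: (taft_lift_x Delta_rel_g Delta_rel_x Delta_rel_gx). Qed.

Lemma Delta_mon a b : taft_Delta wP (x ^+ a * g ^+ b) =
  \sum_(j < a.+1) qbin w a j *: ((x ^+ (a - j) * g ^+ (j + b)) ⊗ (x ^+ j * g ^+ b)).
Proof.
rewrite rmorphM !rmorphXn /= Delta_g Delta_x (qbinomial Delta_gx_comm) mulr_suml.
apply: eq_bigr => j _; rewrite -scalerAl !tensX !tensM expr1n mul1r.
by rewrite exprD mulrA.
Qed.

Lemma slice_Delta_mon a b (p : ba_idx H) : (a < n)%N ->
  slice p (taft_Delta wP (x ^+ a * g ^+ b)) =
  if (p.1 <= a)%N && (p.2 == (a - p.1 + b) %% n :> nat)%N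
  then qbin w a (a - p.1) *: (x ^+ (a - p.1) * g ^+ b) else 0.
Proof.
move=> an; rewrite Delta_mon linear_sum /=.
have E (j : 'I_a.+1) : slice p (qbin w a j *:
    ((x ^+ (a - j) * g ^+ (j + b)) ⊗ (x ^+ j * g ^+ b))) =
    if (p.1 == a - j :> nat)%N && (p.2 == (j + b) %% n :> nat)%N
    then qbin w a j *: (x ^+ j * g ^+ b) else 0.
  rewrite linearZ /= slice_tens taft_coord_mon.
  by case: ifP => _; rewrite ?scale1r // scale0r scaler0.
under eq_bigr => j _ do rewrite E.
have [pa|ap] := leqP p.1 a; last first.
  apply: big1 => j _; case: eqP => // pj.
  by move: ap; rewrite pj ltnNge leq_subr.
have sj : (a - p.1 < a.+1)%N by rewrite ltnS leq_subr.
rewrite (bigD1 (Ordinal sj)) //= subKn // eqxx /= big1 ?addr0 // => j.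
rewrite -val_eqE /= => jp; case: eqP => // pj; case/eqP: jp.
by rewrite pj subKn // -ltnS.
Qed.

End TaftLift.

(** * Absorbed elements *)

Section Slices.
Variables (k : fieldType) (n : nat) (w : k) (wP : n.-primitive_root w).
Local Notation H := (taft wP).
Local Notation x := (taft_x wP).
Local Notation g := (taft_g wP).

(** A monomial of highest x-degree occurring in u. It need not be unique, the
    power of g being unconstrained. *)
Definition top_coord (u : H) (p : ba_idx H) : Prop :=
  ba_coord u p != 0 /\ forall q : ba_idx H, (p.1 < q.1)%N -> ba_coord u q = 0.

Lemma top_coord_exists (u : H) : u != 0 -> exists p, top_coord u p.
Proof.
move=> u0; have [q uq] : exists q, ba_coord u q != 0.
  apply/existsP; apply: contraR u0 => /existsPn u0; apply/eqP/ba_eqP => q.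
  by rewrite ba_coord0; apply/eqP; have := u0 q; rewrite negbK.
case: (@arg_maxnP _ q (fun q => ba_coord u q != 0) (fun q => q.1 : nat) uq).
move=> p up pmax; exists p; split=> // r pr; apply/eqP/negPn/negP => /pmax.
by rewrite /= leqNgt pr.
Qed.

Lemma slice_Delta (p : ba_idx H) (u : H) :
  slice p (taft_Delta wP u) =
  \sum_(q : ba_idx H | (p.1 <= q.1)%N && (p.2 == (q.1 - p.1 + q.2) %% n :> nat)%N)
     (ba_coord u q * qbin w q.1 (q.1 - p.1)) *: (x ^+ (q.1 - p.1) * g ^+ q.2).
Proof.
rewrite {1}[u]taft_decomp (linear_sum (taft_Delta wP)) linear_sum [RHS]big_mkcond.
apply: eq_bigr => q _; rewrite !linearZ /= slice_Delta_mon //.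
by case: ifP => _; rewrite ?scalerA ?scaler0.
Qed.

(** Only monomials of x-degree at least i contribute over x^i g^m, and among
    those of x-degree i only x^i g^m itself. *)
Lemma slice_Delta_top (u : H) (p : ba_idx H) :
    (forall q : ba_idx H, (p.1 < q.1)%N -> ba_coord u q = 0) ->
  slice p (taft_Delta wP u) = ba_coord u p *: g ^+ p.2.
Proof.
move=> utop; rewrite slice_Delta (bigD1 p) /=; last first.
  by rewrite leqnn subnn modn_small ?eqxx // ltn_ord.
rewrite subnn qbin0 mulr1 mul1r big1 ?addr0 // => q /andP[/andP[pq /eqP p2] qp].
rewrite leq_eqVlt in pq; case/orP: pq => [/eqP p1|/utop->]; last by rewrite mul0r scale0r.
case/eqP: qp; case: p q p1 p2 {utop} => a b [c d] /= ac.
by rewrite ac subnn add0n modn_small ?ltn_ord // => bd; congr (_, _); apply: val_inj.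
Qed.

(** One degree below the top, x^(i+1) g^(m-1) is the only other monomial that
    contributes over x^i g^m. *)
Lemma slice_Delta_subtop (u : H) (p p' : ba_idx H) :
    (forall q : ba_idx H, (p.1 < q.1)%N -> ba_coord u q = 0) ->
    p.1 = p'.1.+1 :> nat -> p'.2 = (p.2.+1 %% n)%N :> nat ->
  slice p' (taft_Delta wP u) =
    ba_coord u p' *: g ^+ p'.2 + (ba_coord u p * qint w p.1) *: (x * g ^+ p.2).
Proof.
move=> utop p1 p2; rewrite slice_Delta (bigD1 p') /=; last first.
  by rewrite leqnn subnn modn_small ?eqxx // ltn_ord.
rewrite subnn qbin0 mulr1 mul1r (bigD1 p) /=; last first.
  rewrite p1 leqnSn subSnn add1n p2 eqxx /=.
  by apply/eqP => pp; move: p1; rewrite pp => /n_Sn.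
rewrite p1 subSnn qbin1 expr1 big1 ?addr0 // => q /andP[/andP[/andP[p1q /eqP p2q] qp'] qp].
have [/utop->|] := ltnP p.1 q.1; first by rewrite mul0r scale0r.
rewrite leq_eqVlt p1 ltnS => /orP[/eqP q1|qp1]; [case/eqP: qp|case/eqP: qp'].
  case: p q p1 p2 p2q q1 {utop p1q qp'} => a b [c d] /= ap -> bd cp.
  congr (_, _); apply: val_inj; rewrite /= ?ap ?cp //.
  move: bd; rewrite cp subSnn -addn1 addnC => /eqP; rewrite eqn_modDl.
  by rewrite !modn_small // => /eqP.
have e : q.1 = p'.1 :> nat by apply/eqP; rewrite eqn_leq qp1 p1q.
case: p' q e p2q {p1 p2 p1q qp qp1} => a b [c d] /= ca.
by rewrite ca subnn add0n modn_small ?ltn_ord // => bd; congr (_, _); apply: val_inj.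
Qed.

(** For fixed P, these u form a left coideal subalgebra, on which
    u P = eps(u) P; the projection identity
    Delta(P) (1 ⊗ P) = P ⊗ P says that it contains P. *)
Definition absorbed (P u : H) : Prop :=
  taft_Delta wP u * (1 ⊗ P) = u ⊗ P.

Lemma absorbedX P y i : absorbed P y -> absorbed P (y ^+ i).
Proof.
move=> yP; rewrite /absorbed; elim: i => [|i IH]; first by rewrite rmorph1 mul1r.
rewrite exprS rmorphM /= -mulrA IH -[y ^+ i]mul1r -[P in _ ⊗ P]mulr1 -tensM.
by rewrite mulrA yP tensM !mulr1 mul1r.
Qed.

Lemma absorbedZ P c u : absorbed P u -> absorbed P (c *: u).
Proof. by move=> uP; rewrite /absorbed linearZ -scalerAl uP tensZl. Qed.

Lemma absorbedD P u v : absorbed P u -> absorbed P v -> absorbed P (u + v).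
Proof. by move=> uP vP; rewrite /absorbed linearD mulrDl uP vP tensDl. Qed.

Lemma absorbed_sum P (I : finType) (F : I -> H) :
  (forall i, absorbed P (F i)) -> absorbed P (\sum_i F i).
Proof.
move=> FP; rewrite /absorbed linear_sum mulr_suml tens_suml.
by apply: eq_bigr => i _; apply: FP.
Qed.

Lemma absorbed_slice P u p :
  absorbed P u -> slice p (taft_Delta wP u) * P = ba_coord u p *: P.
Proof. by move=> uP; rewrite -slice_mulr uP slice_tens. Qed.

Lemma absorbed_top P u p : absorbed P u -> top_coord u p -> g ^+ p.2 * P = P.
Proof.
move=> uP [up utop]; have := absorbed_slice p uP.
by rewrite slice_Delta_top // -scalerAl => /(scalerI up).
Qed.

Local Notation y beta := (g + beta *: x).

Lemma Delta_gbx beta : taft_Delta wP (y beta) = g ⊗ y beta + beta *: (x ⊗ 1).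
Proof.
rewrite linearD linearZ /= Delta_g Delta_x scalerDr [X in _ = X + _]linearD.
by rewrite linearZ addrA addrAC.
Qed.

Lemma absorbed_gbx beta P : y beta * P = P -> absorbed P (y beta).
Proof.
move=> yP; rewrite /absorbed Delta_gbx mulrDl -scalerAl !tensM yP mulr1 mul1r.
by rewrite mulr1 tensDl tensZl.
Qed.

Lemma g_scaled_x beta : g * (beta *: x) = w *: ((beta *: x) * g).
Proof. by rewrite -scalerAr taft_gx -scalerAl !scalerA mulrC. Qed.

(** This is [qfreshman] for beta x and g. *)
Lemma gbx_order beta : y beta ^+ n = 1.
Proof.
rewrite addrC (qfreshman wP (g_scaled_x beta)) exprZn taft_x_nilp scaler0 add0r.
exact: taft_g_order.
Qed.

(** The monomials of y^m are x^(m-j) g^j with j <= m < n, so that g^0 comes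
    from j = 0 only. *)
Lemma gbx_pow_coord beta (m : 'I_n) (i z : 'I_n) : z = 0 :> nat ->
  ba_coord (y beta ^+ m) ((i, z) : ba_idx H) = beta ^+ m *+ (i == m).
Proof.
move=> z0; rewrite addrC (qbinomial (g_scaled_x beta)) ba_coord_sum.
rewrite big_ord_recl big1 => [|j _].
  rewrite Monoid.mulm1 qbin0 scale1r subn0 exprZn -scalerAl ba_coordZ taft_coord_mon.
  by rewrite /= z0 mod0n eqxx andbT mulr_natr.
rewrite exprZn -scalerAl !ba_coordZ taft_coord_mon /= z0.
rewrite modn_small ?andbF ?mulr0 // (leq_trans _ (ltn_ord m)) //.
by rewrite /bump leq0n add1n ltnS ltn_ord.
Qed.

End Slices.

(** * Classification of the right group-like projections *)

Section Classification.
Variables (k : fieldType) (n : nat) (w : k) (wP : n.-primitive_root w).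
Hypothesis n_ge2 : (2 <= n)%N.
Local Notation H := (taft wP).
Local Notation x := (taft_x wP).
Local Notation g := (taft_g wP).
Local Notation y beta := (g + beta *: x).

Lemma taft_group_projE d : (d %| n)%N ->
  taft_group_proj wP d = avg_pow (g ^+ d) (n %/ d).
Proof.
move=> dn; rewrite /taft_group_proj /avg_pow; congr (_ *: _).
  have n0 := prim_root_natf_neq0 wP; have d0 := prim_root_dvd_eq0 wP dn.
  rewrite -[in X in _ / X](divnK dn) natrM invfM mulrCA mulfV ?mulr1 //.
by apply: eq_bigr => i _; rewrite exprM.
Qed.

Lemma taft_PE beta : taft_P wP beta = avg_pow (y beta) n.
Proof. by []. Qed.

Lemma natr_divn_neq0 d : (d %| n)%N -> (n %/ d)%:R != 0 :> k.
Proof.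
move=> dn; apply: (prim_root_dvd_eq0 wP); apply/dvdnP; exists d.
by rewrite mulnC divnK.
Qed.

(** If x P = 0 then, x and g commuting up to scalars, the monomials of positive
    x-degree kill P, while those of P of x-degree 0 vanish; so P P = 0. *)
Lemma idem_x_neq0 P : P != 0 -> P * P = P -> x * P != 0 :> H.
Proof.
move=> P0 PP; apply: contraNneq P0 => xP; rewrite -PP {1}[P]taft_decomp.
rewrite mulr_suml big1 // => -[a b] _ /=; rewrite -scalerAl.
have [a0|a0] := posnP a.
  suff -> : ba_coord P (a, b) = 0 by rewrite scale0r.
  have := congr1 (fun u => @ba_coord k H u (Ordinal n_ge2, b)) xP.
  rewrite /= ba_coord0 [P in x * P]taft_decomp mulr_sumr ba_coord_sum => <-.
  rewrite (bigD1 (a, b)) //= big1 => [|[c d] cd].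
    rewrite addr0 -scalerAr ba_coordZ mulrA -exprS taft_coord_mon /= a0 eqxx.
    by rewrite modn_small // eqxx mulr1.
  rewrite -scalerAr ba_coordZ mulrA -exprS taft_coord_mon /= eqSS modn_small //.
  case: eqP => [c0|]; last by rewrite mulr0.
  case: eqP => [bd|]; last by rewrite mulr0.
  by case/eqP: cd; congr (_, _); apply: val_inj; rewrite //= a0.
have w0 : w != 0.
  have := prim_expr_order wP; apply: contra_eq_neq => ->.
  by rewrite expr0n gtn_eqF ?(prim_order_gt0 wP) // eq_sym oner_eq0.
have: g ^+ b * x ^+ a * P = 0.
  by rewrite -(prednK a0) exprSr -!mulrA xP !mulr0.
rewrite (qcommX (taft_gx wP)) -scalerAl => /eqP; rewrite scaler_eq0.
by rewrite expf_eq0 (negPf w0) andbF /= => /eqP->; rewrite scaler0.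
Qed.

(** When P is supported on the group, all its coordinates are top ones, so its
    support lies among the b with g^b P = P, which are the multiples of a
    divisor d of n. *)
Lemma idem_absorbed_group (P : H) :
    P != 0 -> P * P = P -> absorbed P P ->
    (forall q : ba_idx H, (0 < q.1)%N -> ba_coord P q = 0) ->
  exists2 d, (d %| n)%N & P = taft_group_proj wP d.
Proof.
move=> P0 PP Pabs Pdeg; have n0 := prim_order_gt0 wP.
have exd : exists d, (0 < d)%N && (g ^+ d * P == P).
  by exists n; rewrite n0 taft_g_order mul1r eqxx.
case: (ex_minnP exd) => d /andP[d0 /eqP dP] dmin.
have stab b : g ^+ b * P = P -> (d %| b)%N.
  move=> bP; rewrite /dvdn eqn0Ngt; apply/negP => r0.
  have: (d <= b %% d)%N.
    apply: dmin; rewrite r0 -[X in _ == X]bP {2}(divn_eq b d) addnC exprD mulnC.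
    by rewrite exprM -mulrA (expr_fixl _ dP) eqxx.
  by rewrite leqNgt ltn_pmod.
have dn : (d %| n)%N by apply: stab; rewrite taft_g_order mul1r.
exists d => //; rewrite taft_group_projE //.
apply: (@idem_span_pow k _ _ _ _ _ (ba_coord P) (fun p => p.2 %/ d)%N) => //.
- exact: natr_divn_neq0.
- by rewrite -exprM mulnC divnK // taft_g_order.
rewrite [LHS]taft_decomp; apply: eq_bigr => p _.
have [->|Pp] := eqVneq (ba_coord P p) 0; first by rewrite !scale0r.
have p10 : p.1 = 0 :> nat by apply/eqP; rewrite eqn0Ngt; apply: contra Pp => /Pdeg->.
have ptop : top_coord P p by split=> // q; rewrite p10 => /Pdeg.
have dp : (d %| p.2)%N := stab _ (absorbed_top Pabs ptop).
by rewrite p10 mul1r -exprM mulnC divnK.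
Qed.

(** Conjugating by g^b turns g + beta x into g + w^b beta x; both can fix P only
    if their difference, a multiple of x, kills P. *)
Lemma gbx_fixed_stab beta P b : beta != 0 -> x * P != 0 -> y beta * P = P ->
  g ^+ b * P = P -> (n %| b)%N.
Proof.
move=> b0 xP yP bP; rewrite (prim_order_dvd wP) -subr_eq0.
suff: (beta * (w ^+ b - 1)) *: (x * P) == 0.
  by rewrite scaler_eq0 (negPf xP) orbF mulf_eq0 (negPf b0).
have gx : g ^+ b * x = w ^+ b *: (x * g ^+ b).
  by have := qcommX (taft_gx wP) 1 b; rewrite muln1.
have : g ^+ b * (y beta * P) = y beta * P by rewrite yP.
rewrite mulrDl mulrDr [g ^+ b * (g * P)]mulrA -exprSr exprS -mulrA bP => /addrI.
rewrite -scalerAl -scalerAr mulrA gx -scalerAl -mulrA bP scalerA => /eqP.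
by rewrite -subr_eq0 -scalerBl mulrBr mulr1.
Qed.

(** The slice just below a top coordinate of P yields beta with
    (g + beta x) P = P; then P is a combination of the powers of g + beta x,
    since the difference u with the only possible combination is absorbed by P,
    and a top coordinate of u contradicts [gbx_fixed_stab]. *)
Lemma idem_absorbed_skew (P : H) p :
    P != 0 -> P * P = P -> absorbed P P -> top_coord P p -> (0 < p.1)%N ->
  exists2 beta, beta != 0 & P = taft_P wP beta.
Proof.
move=> P0 PP Pabs ptop p1; have xP := idem_x_neq0 P0 PP.
have gP := absorbed_top Pabs ptop; case: (ptop) => Pp Pmax.
have p'n : (p.1.-1 < n)%N by rewrite prednK // ltnW.
pose p' : ba_idx H := (Ordinal p'n, omod wP p.2.+1).
have := absorbed_slice p' Pabs.
rewrite (@slice_Delta_subtop _ _ _ _ _ p) //= ?prednK // -taft_g_mod.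
set c := ba_coord P p'; set s := ba_coord P p * _.
have s0 : s != 0 by rewrite mulf_neq0 // (qint_neq0 wP) // p1 ltn_ord.
rewrite mulrDl -!scalerAl exprS -!mulrA gP => eqP'.
have c0 : c != 0.
  apply: contraNneq xP => c0; move: eqP'; rewrite c0 !scale0r add0r => /eqP.
  by rewrite scaler_eq0 (negPf s0).
pose beta := s / c; have b0 : beta != 0 by rewrite mulf_neq0 ?invr_eq0.
have yP : y beta * P = P.
  apply: (scalerI c0); rewrite -[RHS]eqP' mulrDl scalerDr -scalerAl scalerA.
  by rewrite /beta mulrC divfK.
exists beta => //; rewrite taft_PE.
have z0 : (0 < n)%N := prim_order_gt0 wP; pose z := Ordinal z0.
(* By gbx_pow_coord, these are the coefficients for which P and the
   combination of powers agree at every x^m g^0. *)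
pose d (m : 'I_n) := ba_coord P ((m, z) : ba_idx H) / beta ^+ m.
apply: (@idem_span_pow k _ _ _ _ _ d (fun m => m : nat)) => //.
- exact: prim_root_natf_neq0 wP.
- exact: gbx_order.
apply/eqP; rewrite -subr_eq0; set u := _ - _; apply/negPn/negP => u0.
have uabs : absorbed P u.
  rewrite /u -scaleN1r; apply/absorbedD/absorbedZ/absorbed_sum => // m.
  exact/absorbedZ/absorbedX/absorbed_gbx.
have [[i b] itop] := top_coord_exists u0.
have /(gbx_fixed_stab b0 xP yP) := absorbed_top uabs itop.
rewrite /= => nb; have bz : b = z.
  by apply: val_inj; move: nb; rewrite /dvdn modn_small // => /eqP.
case: itop => /negP[]; rewrite bz /u -scaleN1r ba_coordD ba_coordZ ba_coord_sum.
rewrite (bigD1 i) //= big1 => [|j ji].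
  by rewrite addr0 ba_coordZ gbx_pow_coord // eqxx mulr1n divfK ?expf_neq0 // mulN1r subrr.
by rewrite ba_coordZ gbx_pow_coord // eq_sym (negPf ji) mulr0.
Qed.

Lemma rgp_cases (P : H) : right_grouplike_projection (taft_Delta wP) P ->
  (exists2 d, (d %| n)%N & P = taft_group_proj wP d) \/
  (exists2 beta, beta != 0 & P = taft_P wP beta).
Proof.
case=> P0 PP Pabs _; have [p ptop] := top_coord_exists P0.
have [p1|p1] := posnP p.1; last by right; apply: idem_absorbed_skew ptop p1.
by left; apply: idem_absorbed_group => // q; case: ptop => _; rewrite p1; apply.
Qed.

(** Both projection identities pass from z to its powers by multiplicativity of
    the coproduct, and then to their average. *)
Lemma rgp_avg_pow (z : H) N (E := avg_pow z N) :
    N%:R != 0 :> k -> z ^+ N = 1 -> E != 0 ->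
    taft_Delta wP z * (1 ⊗ E) = z ⊗ E -> (1 ⊗ E) * taft_Delta wP z = z ⊗ E ->
  right_grouplike_projection (taft_Delta wP) E.
Proof.
move=> N0 zN E0 zE Ez; split=> //; first exact: avg_pow_idem.
  rewrite {1 3}/E /avg_pow !big_mkord.
  by apply/absorbedZ/absorbed_sum => i; apply: absorbedX.
rewrite {2 3}/E /avg_pow (linearZ_LR (taft_Delta wP)) -scalerAr tensZl; congr (_ *: _).
rewrite !big_mkord (linear_sum (taft_Delta wP)) mulr_sumr tens_suml.
apply: eq_bigr => i _; elim: {i}(i : nat) => [|i IH]; first by rewrite rmorph1 mulr1.
rewrite exprSr rmorphM /= mulrA IH -[z ^+ i]mulr1 -[E in _ ⊗ E]mul1r -tensM.
by rewrite -mulrA Ez tensM mulr1 mul1r.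
Qed.

End Classification.

(** * Realization of the projections *)

Lemma avg_pow_rmorph (k : fieldType) (A B : algType k) (f : {lrmorphism A -> B})
    y N : f (avg_pow y N) = avg_pow (f y) N.
Proof.
rewrite /avg_pow linearZ rmorph_sum /=; congr (_ *: _).
by apply: eq_bigr => i _; rewrite rmorphXn.
Qed.

Section Realization.
Variables (k : fieldType) (n : nat) (w : k) (wP : n.-primitive_root w).
Local Notation H := (taft wP).
Local Notation x := (taft_x wP).
Local Notation g := (taft_g wP).
Local Notation y beta := (g + beta *: x).

(** The character e is applied with e the counit, which is 1 on g and on
    g + beta x; it sends the average to 1. *)
Lemma avg_pow_neq0 (z : H) N (e : {lrmorphism H -> k^o}) :
  N%:R != 0 :> k -> e z = 1 -> avg_pow z N != 0.
Proof.
move=> N0 ez; apply/eqP => z0; have := avg_pow_rmorph e z N; rewrite z0 linear0 ez.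
rewrite /avg_pow; under eq_bigr => i _ do rewrite expr1n.
rewrite sumr_const_nat subn0 => /esym/eqP.
by rewrite -[_ *: _]/(_ * _) mulVf // oner_eq0.
Qed.

Lemma counit_exists :
  exists e : {lrmorphism H -> k^o}, e g = 1 /\ e x = 0.
Proof.
have n0 := prim_order_gt0 wP.
have Gn : (1 : k^o) ^+ n = 1 by rewrite expr1n.
have Xn : (0 : k^o) ^+ n = 0 by rewrite expr0n gtn_eqF.
have GX : (1 : k^o) * 0 = w *: (0 * 1) by rewrite mulr0 mul0r scaler0.
by exists (taft_lift Gn Xn GX); split; [exact: taft_lift_g|exact: taft_lift_x].
Qed.

Lemma rgp_group_proj d : (d %| n)%N ->
  right_grouplike_projection (taft_Delta wP) (taft_group_proj wP d).
Proof.
move=> dn; rewrite taft_group_projE //; have N0 := natr_divn_neq0 wP dn.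
have zN : (g ^+ d) ^+ (n %/ d) = 1 by rewrite -exprM mulnC divnK // taft_g_order.
have [e [eg _]] := counit_exists.
apply: rgp_avg_pow => //.
- by apply: (avg_pow_neq0 (e := e)) => //; rewrite rmorphXn /= eg expr1n.
- by rewrite rmorphXn /= Delta_g tensX tensM mulr1 avg_pow_fixl.
- by rewrite rmorphXn /= Delta_g tensX tensM mul1r avg_pow_fixr.
Qed.

Lemma rgp_taft_P beta :
  right_grouplike_projection (taft_Delta wP) (taft_P wP beta).
Proof.
have N0 := prim_root_natf_neq0 wP; have yn := gbx_order wP beta.
have [e [eg ex]] := counit_exists.
rewrite taft_PE; apply: rgp_avg_pow => //.
- by apply: (avg_pow_neq0 (e := e)) => //; rewrite linearD linearZ /= eg ex scaler0 addr0.
- exact/absorbed_gbx/avg_pow_fixl.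
rewrite Delta_gbx mulrDr -scalerAr !tensM !mul1r mulr1 avg_pow_fixr //.
by rewrite tensDl tensZl.
Qed.

End Realization.

(** * Hopf automorphisms of the Taft algebra *)

Section Automorphisms.
Variables (k : fieldType) (n : nat) (w : k) (wP : n.-primitive_root w).
Local Notation H := (taft wP).
Local Notation x := (taft_x wP).
Local Notation g := (taft_g wP).

Lemma taft_lrmorph_ext (B : algType k) (f h : {lrmorphism H -> B}) :
  f g = h g -> f x = h x -> f =1 h.
Proof.
move=> fg fx; apply: eq_on_basis => p.
by rewrite taft_basis_mon !rmorphM !rmorphXn /= fg fx.
Qed.

Section Scaling.
Variable lam : k.

Fact scale_rel_x : (lam *: x) ^+ n = 0.
Proof. by rewrite exprZn taft_x_nilp scaler0. Qed.

Definition taft_scale : H -> H :=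
  taft_lift (taft_g_order wP) scale_rel_x (g_scaled_x wP lam).

HB.instance Definition _ := GRing.LRMorphism.copy taft_scale
  (taft_lift (taft_g_order wP) scale_rel_x (g_scaled_x wP lam)).

Lemma taft_scale_g : taft_scale g = g.
Proof. exact: taft_lift_g. Qed.

Lemma taft_scale_x : taft_scale x = lam *: x.
Proof. exact: taft_lift_x. Qed.

Lemma taft_scale_mon a b :
  taft_scale (x ^+ a * g ^+ b) = lam ^+ a *: (x ^+ a * g ^+ b).
Proof. by rewrite /taft_scale taft_lift_mon exprZn scalerAl. Qed.

End Scaling.

Lemma taft_scaleK lam mu : lam * mu = 1 -> cancel (taft_scale lam) (taft_scale mu).
Proof.
move=> lm u; apply: (@taft_lrmorph_ext H (taft_scale mu \o taft_scale lam) idfun) => /=.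
  by rewrite !taft_scale_g.
by rewrite taft_scale_x linearZ /= taft_scale_x scalerA lm scale1r.
Qed.

Lemma taft_scale_hopf lam : lam != 0 ->
  hopf_automorphism (taft_Delta wP) (taft_eps wP) (taft_S wP) (taft_scale lam).
Proof.
move=> l0; split.
- by exists (taft_scale lam^-1); apply: taft_scaleK; rewrite ?mulfV ?mulVf.
- move=> u; apply: (@eq_on_basis _ H _ (taft_Delta wP \o taft_scale lam)
    (tens_map (taft_scale lam) (taft_scale lam) \o taft_Delta wP)) => p.
  rewrite taft_basis_mon /= taft_scale_mon linearZ /= Delta_mon !linear_sum.
  apply: eq_bigr => j _; rewrite !linearZ /=; congr (_ *: _).
  rewrite tens_map_tens /= !taft_scale_mon linearZ /= tensZl scalerA -exprD.
  by rewrite subnKC // -ltnS.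
- move=> u; pose E : {linear H -> k^o} :=
    ba_lin (fun p : ba_idx H => ((p.1 == 0 :> nat)%N)%:R).
  apply: (@eq_on_basis _ H _ (E \o taft_scale lam) E) => p /=.
  rewrite taft_basis_mon taft_scale_mon -taft_basis_mon linearZ /= ba_lin_basis.
  by case: eqP => [->|_]; rewrite ?expr0 ?scale1r ?scaler0.
move=> u; pose S : {linear H -> H} := ba_lin (fun p : ba_idx H =>
  (g ^+ n.-1) ^+ p.2 * (- (g ^+ n.-1 * x)) ^+ p.1).
apply: (@eq_on_basis _ H _ (S \o taft_scale lam) (taft_scale lam \o S)) => p /=.
rewrite taft_basis_mon taft_scale_mon -taft_basis_mon linearZ /= ba_lin_basis.
rewrite rmorphM !rmorphXn /= rmorphN rmorphM rmorphXn /= taft_scale_g taft_scale_x.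
by rewrite -scalerAr -scalerN exprZn -scalerAr.
Qed.

Hypothesis n_ge2 : (2 <= n)%N.

Lemma taft_x_neq0 : x != 0.
Proof.
have n0 : (0 < n)%N by apply: ltnW.
apply/eqP => /(congr1 (fun u => @ba_coord k H u (Ordinal n_ge2, Ordinal n0))).
by rewrite ba_coordE ba_coord0 /= => /eqP; rewrite oner_eq0.
Qed.

Lemma prim_root_neq1 : w != 1.
Proof.
rewrite -[w]expr1 -(prim_order_dvd wP) dvdn1.
by case: (n) n_ge2 => [|[]].
Qed.

(** At a top coordinate p of h, the slice of Delta(h) = h ⊗ h is h_p h, and also
    h_p g^b by [slice_Delta_top]. *)
Lemma grouplike_taft (h : H) : h != 0 -> taft_Delta wP h = h ⊗ h ->
  exists b : 'I_n, h = g ^+ b.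
Proof.
move=> /top_coord_exists[p [hp htop]] Dh; exists p.2.
have := slice_Delta_top htop; rewrite Dh slice_tens.
exact: scalerI.
Qed.

(** An element of the group algebra would commute with g^b, which w <> 1
    excludes; so u has positive x-degree, and the slices of its coproduct at
    and just below a top coordinate force g^b = g and u = c (g - 1) + s x. The
    commutation rule then gives c = 0. *)
Lemma skew_primitive_taft (b : 'I_n) (u : H) :
    u != 0 -> taft_Delta wP u = u ⊗ 1 + g ^+ b ⊗ u ->
    g ^+ b * u = w *: (u * g ^+ b) ->
  g ^+ b = g /\ exists2 lam, lam != 0 & u = lam *: x.
Proof.
move=> u0 Du comm; have w1 := prim_root_neq1.
have n0 := prim_order_gt0 wP.
have [p [up utop]] := top_coord_exists u0.
have sl q : slice q (taft_Delta wP u) =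
    ba_coord u q *: 1 + ((q.1 == 0 :> nat) && (q.2 == b :> nat))%:R *: u.
  rewrite Du linearD /= !slice_tens taft_coord_gX.
  by rewrite modn_small.
have [p1|p1] := posnP p.1.
  have gu : g ^+ b * u = u * g ^+ b.
    rewrite [u]taft_decomp mulr_suml mulr_sumr; apply: eq_bigr => q _.
    rewrite -scalerAr -scalerAl.
    have [q1|q1] := posnP q.1; last by rewrite utop ?p1 // !scale0r.
    by rewrite q1 mul1r -!exprD addnC.
  move: comm; rewrite gu -[LHS]scale1r => /eqP; rewrite -subr_eq0 -scalerBl.
  rewrite scaler_eq0 subr_eq0 eq_sym (negPf w1) /= => /eqP ug.
  have gi : g ^+ b * g ^+ (n - b) = 1.
    by rewrite -exprD subnKC ?taft_g_order // ltnW.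
  by case/eqP: u0; rewrite -[u]mulr1 -gi mulrA ug mul0r.
have := slice_Delta_top utop; rewrite sl gtn_eqF // scale0r addr0 => /(scalerI up) gp.
have {}gp : g ^+ p.2 = 1 by rewrite gp.
have p'n : (p.1.-1 < n)%N by rewrite prednK // ltnW.
pose p' : ba_idx H := (Ordinal p'n, omod wP 1).
have p2 : p.2 = 0 :> nat.
  have := congr1 (fun u => @ba_coord k H u (omod wP 0, p.2)) gp.
  rewrite /= (taft_coord_gX 0) taft_coord_gX /= mod0n modn_small // !eqxx /=.
  by case: eqP => // _ /eqP; rewrite oner_eq0.
have := slice_Delta_subtop (p := p) (p' := p') utop.
rewrite sl /= prednK // p2 => /(_ erefl erefl).
rewrite -taft_g_mod mulr1.
set c := ba_coord u p'; set s := ba_coord u p * _ => eqs.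
have s0 : s != 0 by rewrite mulf_neq0 // (qint_neq0 wP) // p1 ltn_ord.
(* The coordinate at x isolates the coefficient of x. *)
have cx c1 c2 c3 : @ba_coord k H (c1 *: g + c2 *: x - c3 *: 1)
    (Ordinal n_ge2, Ordinal n0) = c2.
  rewrite -scaleN1r !ba_coordD !ba_coordZ -[x]mulr1 (taft_coord_mon 1 0).
  rewrite (taft_coord_gX 0) (taft_coord_gX 1) /= mod0n.
  by rewrite !mulr0 mulr1 addr0 add0r.
move: eqs; case: andP => [[/eqP p'1 /eqP p'2]|_]; last first.
  rewrite scale0r addr0 => /eqP; rewrite eq_sym -subr_eq0 => /eqP.
  move/(congr1 (fun u => @ba_coord k H u (Ordinal n_ge2, Ordinal n0))).
  by rewrite /= cx ba_coord0 => /eqP; rewrite (negPf s0).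
have gb : g ^+ b = g by rewrite -p'2 /= -taft_g_mod.
rewrite scale1r => eqs.
pose v : H := g - 1; have ue : u = c *: v + s *: x.
  by rewrite scalerBr addrAC -eqs [c *: 1 + u]addrC addrK.
split=> //; exists s => //; suff c0 : c = 0 by rewrite ue c0 scale0r add0r.
have vg : v * g = g * v by rewrite mulrBl mulrBr mul1r mulr1.
move: comm; rewrite gb ue mulrDl mulrDr -!scalerAr -!scalerAl vg taft_gx.
rewrite scalerDr !scalerA [s * w]mulrC => eqw; have /eqP := addIr _ eqw.
rewrite -subr_eq0 -scalerBl scaler_eq0 -{1}[c]mul1r -mulrBl mulf_eq0 subr_eq0.
rewrite [1 == w]eq_sym (negPf w1) /= => /orP[/eqP //|/eqP].
move/(congr1 (fun u => @ba_coord k H u (Ordinal n0, Ordinal n_ge2))).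
rewrite /= ba_coord0 /v mulrBr mulr1 -expr2 -scaleN1r ba_coordD ba_coordZ.
rewrite (taft_coord_gX 1) taft_coord_gX /= (modn_small n_ge2) eqxx mulr1.
have -> : (1 == 2 %% n)%N = false.
  by case: (n) n_ge2 => [|[|[|m]]].
by rewrite add0r => /eqP; rewrite oppr_eq0 oner_eq0.
Qed.

Lemma hopf_automorphismP (f : {lrmorphism H -> H}) :
  hopf_automorphism (taft_Delta wP) (taft_eps wP) (taft_S wP) f ->
  f g = g /\ exists2 lam, lam != 0 & f x = lam *: x.
Proof.
case=> /bij_inj finj fDelta _ _.
have f_neq0 u : u != 0 -> f u != 0 by rewrite -{2}(rmorph0 f) (inj_eq finj).
have fgn : f g * f (g ^+ n.-1) = 1.
  by rewrite -rmorphM -exprS prednK ?taft_g_order ?rmorph1 // ltnW.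
have [b fg] : exists b : 'I_n, f g = g ^+ b.
  apply: grouplike_taft; last by rewrite fDelta Delta_g tens_map_tens.
  apply: contra_eq_neq fgn => ->; rewrite mul0r eq_sym; exact: oner_neq0.
have Dx : taft_Delta wP (f x) = f x ⊗ 1 + g ^+ b ⊗ f x.
  by rewrite fDelta Delta_x linearD /= !tens_map_tens /= rmorph1 fg.
have comm : g ^+ b * f x = w *: (f x * g ^+ b).
  by rewrite -fg -!rmorphM taft_gx /= linearZ.
have [gb fx] := skew_primitive_taft (f_neq0 _ taft_x_neq0) Dx comm.
by rewrite fg.
Qed.

End Automorphisms.

Section Orbits.
Variables (k : fieldType) (n : nat) (w : k) (wP : n.-primitive_root w).
Hypothesis n_ge2 : (2 <= n)%N.
Local Notation orbit :=
  (hopf_orbit (taft_Delta wP) (taft_eps wP) (taft_S wP)).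

Lemma orbit_group_proj d : (d %| n)%N ->
  orbit (taft_group_proj wP d) = [set taft_group_proj wP d].
Proof.
move=> dn; rewrite taft_group_projE //; apply/seteqP; split=> Q /=.
  case=> f [/(hopf_automorphismP n_ge2)[fg _] ->].
  by rewrite avg_pow_rmorph rmorphXn /= fg.
move=> ->; exists (taft_scale (wP := wP) 1); split; first exact/taft_scale_hopf/oner_neq0.
by rewrite avg_pow_rmorph rmorphXn /= taft_scale_g.
Qed.

Lemma orbit_taft_P beta : beta != 0 ->
  orbit (taft_P wP beta) = [set taft_P wP beta' | beta' in [set b : k | b != 0]].
Proof.
move=> b0; apply/seteqP; split=> Q /=.
  case=> f [/(hopf_automorphismP n_ge2)[fg [lam l0 fx]] ->].
  exists (beta * lam); first by rewrite mulf_neq0.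
  by rewrite !taft_PE avg_pow_rmorph linearD linearZ /= fg fx scalerA.
case=> b' b'0 <-; exists (taft_scale (wP := wP) (b' / beta)).
split; first by apply: taft_scale_hopf; rewrite mulf_neq0 ?invr_eq0.
rewrite !taft_PE avg_pow_rmorph linearD linearZ /= taft_scale_g taft_scale_x.
by rewrite scalerA mulrC divfK.
Qed.

End Orbits.

Theorem corollary4p8 (n : nat) (k : fieldType) (w : k)
    (n_ge2 : (2 <= n)%N) (wP : n.-primitive_root w) :
  taft_orbits wP =
    [set [set taft_group_proj wP d] | d in [set d : nat | (d %| n)%N]]
    `|` [set [set taft_P wP beta | beta in [set beta : k | beta != 0]]].
Proof.
apply/seteqP; split=> O /=.
  case=> P /(rgp_cases n_ge2)[[d dn ->]|[beta b0 ->]] <-.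
    by left; exists d => //; rewrite orbit_group_proj.
  by right; rewrite orbit_taft_P.
case=> [[d dn <-]|->].
  exists (taft_group_proj wP d); first exact: rgp_group_proj.
  exact: orbit_group_proj.
exists (taft_P wP 1); first exact: rgp_taft_P.
exact/orbit_taft_P/oner_neq0.
Qed.
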